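(* Let $(\mathbf{C}, \Sigma, \Gamma)$ be a choice of substrates. Then the possible tasks $(\mathbf{C}, \Sigma, \Gamma)^\checkmark$ form a sub-SMC (sub-symmetric monoidal category) of $\mathbf{Rel}$. That is, taking as objects the sets $\Gamma_H$ for $H \in \Sigma$ and as morphisms the possible tasks between them, the possible tasks contain all identities and all symmetry isomorphisms (swaps) of these objects, and are closed under sequential composition $\circ$ and parallel composition $\times$.
   Context: **Conventions.** SMC means symmetric monoidal category; all monoidal categories are taken to be strict (associativity and unit are equalities; symmetries need not be identities). $\mathbf{Rel}$ is the SMC of sets and relations, with the Cartesian product as monoidal product on objects and a chosen singleton $1=\{*\}$ acting as strict unit ($X\times 1 = X = 1\times X$, and tuples are not nested). A task $\mathfrak{A}: X\to Y$ is a relation $\mathfrak{A}\subseteq X\times Y$; write $x\mapsto y$ for a pair $(x,y)$ in it. - Sequential composition of $\mathfrak{A}: X\to Y$ and $\mathfrak{B}: Y\to Z$: $\mathfrak{B}\circ\mathfrak{A} = \{x\mapsto z \mid \exists y\in Y,\ (x,y)\in\mathfrak{A} \text{ and } (y,z)\in\mathfrak{B}\}$. - Parallel composition of $\mathfrak{A}: X\to Y$ and $\mathfrak{B}: Z\to W$: $\mathfrak{A}\times\mathfrak{B} = \{(x,z)\mapsto(y,w) \mid (x,y)\in\mathfrak{A},\ (z,w)\in\mathfrak{B}\}: X\times Z\to Y\times W$. - Symmetry isomorphisms: $\sigma_{X,Y} = \{(x,y)\mapsto(y,x)\mid x\in X, y\in Y\}: X\times Y\to Y\times X$. An attribute on a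 set $X$ is a subset $S\subseteq X$, identified with the relation $\{*\mapsto x \mid x\in S\}: 1\to X$. **Choice of substrates.** A choice of substrates $(\mathbf{C},\Sigma,\Gamma)$ comprises: 1. a strict SMC $\mathbf{C}$ with tensor $\otimes$ and unit $I$ (the theory of processes); 2. a subset $\Sigma\subseteq\mathrm{obj}(\mathbf{C})$ (the substrates); 3. a family $\Gamma=(\Gamma_H)_{H\in\Sigma}$, where $\Gamma_H$ is a set of states of $H$ in $\mathbf{C}$, i.e. of morphisms $I\to H$. It is required that $I\in\Sigma$, that $H\otimes K\in\Sigma$ for all $H,K\in\Sigma$, that $\Gamma_I=1$, and that $\Gamma_{H\otimes K}=\Gamma_H\times\Gamma_K$ for all $H,K\in\Sigma$ (where the pair $(\rho,\sigma)\in\Gamma_H\times\Gamma_K$ is identified with the state $\rho\otimes\sigma$ of $H\otimes K$, and the single element of $1$ with $\mathrm{id}_I$). **Induced tasks.** For $H,K\in\Sigma$, a process (morphism) $f: H\to K$ in $\mathbf{C}$ is task-inducing if $f(\rho):=f\circ\rho\in\Gamma_K$ for all $\rho\in\Gamma_H$. The task induced by $f$ is $\lfloor f\rfloor := \{\rho\mapsto f(\rho)\mid\rho\in\Gamma_H\}:\Gamma_H\to\Gamma_K$. **Possible tasks.** For $H,K\in\Sigma$, a task $\mathfrak{A}:\Gamma_H\to\Gamma_K$ is possible if there exist a substrate $C\in\Sigma$, an attribute $P\subseteq\Gamma_C$, and a task-inducing process $f: H\otimes C\to K\otimes C$ such that: 1. $\mathfrak{A}=\{\rho\mapsto\rho'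 \mid \exists\gamma\in P,\ \gamma'\in\Gamma_C,\ f(\rho\otimes\gamma)=\rho'\otimes\gamma'\}$, where $\rho \in \Gamma_H$ and $\rho' \in \Gamma_K$; 2. $P$ is preserved by $\lfloor f\rfloor$: whenever $\rho\in\Gamma_H$, $\gamma\in P$, $\rho'\in\Gamma_K$, $\gamma'\in\Gamma_C$ satisfy $f(\rho\otimes\gamma)=\rho'\otimes\gamma'$, one has $\gamma'\in P$. $(\mathbf{C},\Sigma,\Gamma)^\checkmark$ denotes the set of possible tasks under the given choice of substrates. *)

(* Defs.v *)
From mathcomp Require Import all_boot.
From mathcomp Require Import boolp classical_sets functions.

Set Implicit Arguments.
Unset Strict Implicit.
Unset Printing Implicit Defensive.

Local Open Scope classical_set_scope.

(* Strictness makes (A ⊗ B) ⊗ C and A ⊗ (B ⊗ C) equal only propositionally, so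
   the laws on morphisms whose two sides have different types need transport. *)
Definition cast (O : Type) (hom : O -> O -> Type) (A A' B B' : O)
    (eA : A = A') (eB : B = B') (f : hom A B) : hom A' B' :=
  ecast X (hom X B') eA (ecast Y (hom A Y) eB f).

(* [hcomp g f] is g ∘ f. *)
Record strictSMC := StrictSMC {
  obj :> Type;
  hom : obj -> obj -> Type;
  idm : forall A, hom A A;
  hcomp : forall A B C, hom B C -> hom A B -> hom A C;
  unitO : obj;
  tensO : obj -> obj -> obj;
  tensM : forall A B A' B', hom A A' -> hom B B' ->
    hom (tensO A B) (tensO A' B');
  sym : forall A B, hom (tensO A B) (tensO B A);
  hcomp1m : forall A B (f : hom A B), hcomp (idm B) f = f;
  hcompm1 : forall A B (f : hom A B), hcomp f (idm A) = f;
  hcompA : forall A B C D (h : hom C D) (g : hom B C) (f : hom A B),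
    hcomp h (hcomp g f) = hcomp (hcomp h g) f;
  tensM1 : forall A B, tensM (idm A) (idm B) = idm (tensO A B);
  tensM_comp : forall A B C A' B' C' (g : hom B C) (f : hom A B)
      (g' : hom B' C') (f' : hom A' B'),
    tensM (hcomp g f) (hcomp g' f') = hcomp (tensM g g') (tensM f f');
  tensA : forall A B C, tensO (tensO A B) C = tensO A (tensO B C);
  tens1o : forall A, tensO unitO A = A;
  tenso1 : forall A, tensO A unitO = A;
  tensMA : forall A B C A' B' C' (f : hom A A') (g : hom B B') (h : hom C C'),
    cast (tensA A B C) (tensA A' B' C') (tensM (tensM f g) h) =
    tensM f (tensM g h);
  tens1M : forall A B (f : hom A B),
    cast (tens1o A) (tens1o B) (tensM (idm unitO) f) = f;
  tensM1r : forall A B (f : hom A B),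
    cast (tenso1 A) (tenso1 B) (tensM f (idm unitO)) = f;
  sym_nat : forall A B A' B' (f : hom A A') (g : hom B B'),
    hcomp (sym A' B') (tensM f g) = hcomp (tensM g f) (sym A B);
  symK : forall A B, hcomp (sym B A) (sym A B) = idm (tensO A B);
  (* σ_{A, B⊗C} = (id_B ⊗ σ_{A,C}) ∘ (σ_{A,B} ⊗ id_C) *)
  sym_hex : forall A B C,
    sym A (tensO B C) =
    cast (tensA A B C) erefl
      (hcomp (cast (esym (tensA B A C)) (esym (tensA B C A))
               (tensM (idm B) (sym A C)))
            (tensM (sym A B) (idm C)))
}.

Arguments hom {s}.
Arguments idm {s}.
Arguments hcomp {s A B C}.
Arguments unitO {s}.
Arguments tensO {s}.
Arguments tensM {s A B A' B'}.
Arguments sym {s}.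
Arguments tens1o {s}.

(* The state ρ ⊗ σ : I -> H ⊗ K, using I ⊗ I = I. *)
Definition tens_state (C : strictSMC) (H K : C)
    (rho : hom unitO H) (sigma : hom unitO K) : hom unitO (tensO H K) :=
  cast (tens1o unitO) erefl (tensM rho sigma).

(* [states] is total on objects; its values outside [substrates] play no role.
   The equality Γ_{H⊗K} = Γ_H × Γ_K, under the identification of (ρ, σ) with
   ρ ⊗ σ, says that (ρ, σ) |-> ρ ⊗ σ is a bijection from Γ_H × Γ_K onto
   Γ_{H⊗K}. *)
Record substrate_choice := SubstrateChoice {
  theory :> strictSMC;
  substrates : set theory;
  states : forall H : theory, set (hom unitO H);
  substrates_unit : substrates unitO;
  substrates_tens : forall H K,
    substrates H -> substrates K -> substrates (tensO H K);
  states_unit : @states unitO = [set idm unitO];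
  states_tens : forall H K, substrates H -> substrates K ->
    set_bij (@states H `*` @states K) (@states (tensO H K))
      (fun p => tens_state p.1 p.2)
}.

Arguments states {s} H.

Definition task (X Y : Type) := set (X * Y).

Definition task_prod (X Y Z W : Type) (A : task X Y) (B : task Z W) :
    task (X * Z) (Y * W) :=
  [set p | A (p.1.1, p.2.1) /\ B (p.1.2, p.2.2)].

Definition task_swap (X Y : Type) : task (X * Y) (Y * X) :=
  [set p | p.2 = (p.1.2, p.1.1)].

Section SubstrateChoice.
Variable S : substrate_choice.
Implicit Types H K C : S.

(* A task between products Γ_H × Γ_K, read as a task between the sets Γ_{H⊗K}
   through the identification of (ρ, σ) with ρ ⊗ σ. *)
Definition on_tens H K H' K'
    (A : task (states H * states K) (states H' * states K')) :
    task (states (tensO H K)) (states (tensO H' K')) :=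
  [set p | exists x y, [/\ A (x, y),
     \val p.1 = tens_state (\val x.1) (\val x.2) &
     \val p.2 = tens_state (\val y.1) (\val y.2)]].

Definition task_inducing H K (f : hom H K) : Prop :=
  forall rho, states H rho -> states K (hcomp f rho).

Definition possible H K (A : task (states H) (states K)) : Prop :=
  exists (C : S) (P : set (states C)) (f : hom (tensO H C) (tensO K C)),
  let maps (rho : states H) (gamma : states C)
      (rho' : states K) (gamma' : states C) :=
    hcomp f (tens_state (\val rho) (\val gamma)) =
    tens_state (\val rho') (\val gamma') in
  [/\ substrates C,
      task_inducing f,
      A = [set p | exists gamma gamma',
             P gamma /\ maps p.1 gamma p.2 gamma'] &
      forall rho gamma rho' gamma',
        P gamma -> maps rho gamma rho' gamma' -> P gamma'].

End SubstrateChoice.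

(* Main.v *)
Require Import Defs.
From mathcomp Require Import all_boot.
From mathcomp Require Import boolp classical_sets functions.

Set Implicit Arguments.
Unset Strict Implicit.
Unset Printing Implicit Defensive.

(** A possible task is realised by a process [f] together with a catalyst: a
    substrate whose attribute [P] survives the use of [f].  Identities and swaps
    need no catalyst, so the unit serves; the swap of tasks is induced by the
    symmetry of the theory.  Two tasks with catalysts [D, P] and [E, Q] are
    combined over the catalyst [D ⊗ E] with attribute [P × Q]: for sequential
    composition [f] runs with [D] while [E] idles, then [g] runs with [E] while
    [D] idles; for parallel composition [f ⊗ g] runs between two shuffles that
    bring each input next to its own catalyst.

    The combined process computes the right product states as soon as the
    structural processes permute the factors of product states as expected
    ([assoc_app], [unassoc_app], [sym_app]).  For the symmetry this rests on
    [sym_unit], the one coherence fact about symmetries that the proof uses.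
    Equality of the resulting tasks, and preservation of [P × Q], then come from
    two properties of the product decomposition of states.  A task-inducing
    process sends a product state to some product state
    ([task_inducing_tens_app]), so intermediate outputs always exist; and a
    product state has a single pair of factors ([tens_states_inj]), so the
    output named in the relation is the one computed stage by stage. *)

(** * Transport of morphisms along equalities of objects *)

Section Cast.
Variable C : strictSMC.
Implicit Types A B X Y : C.

Lemma cast_irr A A' B B' (e1 e2 : A = A') (e3 e4 : B = B') (f : hom A B) :
  cast e1 e3 f = cast e2 e4 f.
Proof. by rewrite (Prop_irrelevance e1 e2) (Prop_irrelevance e3 e4). Qed.

Lemma cast_cast A A' A'' B B' B'' (e1 : A = A') (e2 : A' = A'')
    (e3 : B = B') (e4 : B' = B'') (f : hom A B) :
  cast e2 e4 (cast e1 e3 f) = cast (etrans e1 e2) (etrans e3 e4) f.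
Proof. by case: A'' / e2; case: B'' / e4; case: A' / e1; case: B' / e3. Qed.

Lemma cast_inj A A' B B' (eA : A = A') (eB : B = B') :
  injective (@cast C hom A A' B B' eA eB).
Proof. by case: A' / eA; case: B' / eB. Qed.

Lemma castK A A' B B' (eA : A = A') (eB : B = B') (f : hom A B) :
  cast (esym eA) (esym eB) (cast eA eB f) = f.
Proof. by case: A' / eA; case: B' / eB. Qed.

(** The middle object may be reached by two different proofs: composites of
    coherence equalities rarely agree syntactically. *)
Lemma hcomp_cast A A' B B' X X' (eA : A = A') (eB eB' : B = B') (eX : X = X')
    (g : hom B X) (f : hom A B) :
  hcomp (cast eB eX g) (cast eA eB' f) = cast eA eX (hcomp g f).
Proof.
move: eB'; case: B' / eB => eB; rewrite (Prop_irrelevance eB erefl).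
by case: A' / eA; case: X' / eX.
Qed.

Lemma hcomp_cast_dom A A' B X (eA : A = A') (g : hom B X) (f : hom A B) :
  hcomp g (cast eA erefl f) = cast eA erefl (hcomp g f).
Proof. by case: A' / eA. Qed.

Lemma hcomp_cast_cod A B X X' (eX : X = X') (g : hom B X) (f : hom A B) :
  hcomp (cast erefl eX g) f = cast erefl eX (hcomp g f).
Proof. by case: X' / eX. Qed.

Lemma tensM_cast_domr A B A' B' B2 (e : B = B2) (f : hom A A') (g : hom B B') :
  tensM f (cast e erefl g) = cast (congr1 (tensO A) e) erefl (tensM f g).
Proof. by case: B2 / e. Qed.

Lemma tensM_cast_doml A B A' B' A2 (e : A = A2) (f : hom A A') (g : hom B B') :
  tensM (cast e erefl f) g = cast (congr1 (tensO^~ B) e) erefl (tensM f g).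
Proof. by case: A2 / e. Qed.

Lemma sym_cast A A' B B' (eA : A = A') (eB : B = B')
    (e : tensO A B = tensO A' B') (e' : tensO B A = tensO B' A') :
  sym A' B' = cast e e' (sym A B).
Proof.
case: A' / eA e e'; case: B' / eB => e e'.
by rewrite (Prop_irrelevance e erefl) (Prop_irrelevance e' erefl).
Qed.

End Cast.

(** * Structural processes acting on product states *)

Section Structure.
Variable C : strictSMC.
Implicit Types A B X Y : C.

Lemma tens_app A A' B B' (f : hom A A') (g : hom B B')
    (r : hom unitO A) (s : hom unitO B) :
  hcomp (tensM f g) (tens_state r s) = tens_state (hcomp f r) (hcomp g s).
Proof. by rewrite /tens_state hcomp_cast_dom tensM_comp. Qed.

(** In the hexagon for three copies of the unit, all three symmetries are
    transports of [s], so it reads [s = s ∘ s]; but [s] is an involution. *)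
Lemma sym_unit : sym (@unitO C) unitO = idm (tensO unitO unitO).
Proof.
set s := sym _ _.
have tl : tensM (idm unitO) s = cast (esym (tens1o _)) (esym (tens1o _)) s.
  by rewrite -{2}(tens1M s) castK.
have tr : tensM s (idm unitO) = cast (esym (tenso1 _)) (esym (tenso1 _)) s.
  by rewrite -{2}(tensM1r s) castK.
have idem : s = hcomp s s.
  have := sym_hex (@unitO C) unitO unitO.
  have eI := esym (tens1o (@unitO C)).
  rewrite (sym_cast erefl eI (congr1 _ eI) (congr1 (tensO^~ unitO) eI)) -/s tl tr.
  rewrite cast_cast hcomp_cast cast_cast => idem.
  exact: cast_inj (etrans idem (cast_irr _ _ _ _ _)).
by rewrite idem symK.
Qed.

(** By naturality the symmetry moves past [r ⊗ s] to the unit, where it is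
    trivial. *)
Lemma sym_app A B (r : hom unitO A) (s : hom unitO B) :
  hcomp (sym A B) (tens_state r s) = tens_state s r.
Proof.
by rewrite /tens_state hcomp_cast_dom sym_nat sym_unit hcompm1.
Qed.

(** The identity process of a triple tensor, typed between its two bracketings:
    with it, rebracketing is a composition and no transport is left. *)
Definition assoc A B X : hom (tensO (tensO A B) X) (tensO A (tensO B X)) :=
  cast erefl (tensA A B X) (idm _).

Definition unassoc A B X : hom (tensO A (tensO B X)) (tensO (tensO A B) X) :=
  cast erefl (esym (tensA A B X)) (idm _).

Lemma assoc_app A B X (r : hom unitO A) (s : hom unitO B) (t : hom unitO X) :
  hcomp (assoc A B X) (tens_state (tens_state r s) t) =
  tens_state r (tens_state s t).
Proof.
rewrite hcomp_cast_cod hcomp1m /tens_state tensM_cast_doml tensM_cast_domr.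
rewrite -tensMA !cast_cast; exact: cast_irr.
Qed.

Lemma unassoc_app A B X (r : hom unitO A) (s : hom unitO B) (t : hom unitO X) :
  hcomp (unassoc A B X) (tens_state r (tens_state s t)) =
  tens_state (tens_state r s) t.
Proof.
rewrite -assoc_app !hcomp_cast_cod !hcomp1m cast_cast.
by rewrite (cast_irr _ erefl _ erefl).
Qed.

Definition exch A B X : hom (tensO A (tensO B X)) (tensO B (tensO A X)) :=
  hcomp (assoc B A X) (hcomp (tensM (sym A B) (idm X)) (unassoc A B X)).

Lemma exch_app A B X (r : hom unitO A) (s : hom unitO B) (t : hom unitO X) :
  hcomp (exch A B X) (tens_state r (tens_state s t)) =
  tens_state s (tens_state r t).
Proof.
by rewrite -!hcompA unassoc_app tens_app sym_app hcomp1m assoc_app.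
Qed.

Definition interchange A B X Y :
    hom (tensO (tensO A B) (tensO X Y)) (tensO (tensO A X) (tensO B Y)) :=
  hcomp (unassoc A X (tensO B Y))
    (hcomp (tensM (idm A) (exch B X Y)) (assoc A B (tensO X Y))).

Lemma interchange_app A B X Y (a : hom unitO A) (b : hom unitO B)
    (x : hom unitO X) (y : hom unitO Y) :
  hcomp (interchange A B X Y) (tens_state (tens_state a b) (tens_state x y)) =
  tens_state (tens_state a x) (tens_state b y).
Proof.
by rewrite -!hcompA assoc_app tens_app exch_app hcomp1m unassoc_app.
Qed.

(** The process [f] uses the first two factors while the third idles. *)
Definition act_first A B X Y (f : hom (tensO A X) (tensO B X)) :
    hom (tensO A (tensO X Y)) (tensO B (tensO X Y)) :=
  hcomp (assoc B X Y) (hcomp (tensM f (idm Y)) (unassoc A X Y)).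

Lemma act_first_app A B X Y (f : hom (tensO A X) (tensO B X))
    (a : hom unitO A) (x : hom unitO X) (y : hom unitO Y)
    (b : hom unitO B) (x' : hom unitO X) :
  hcomp f (tens_state a x) = tens_state b x' ->
  hcomp (act_first Y f) (tens_state a (tens_state x y)) =
  tens_state b (tens_state x' y).
Proof.
by move=> fax; rewrite -!hcompA unassoc_app tens_app fax hcomp1m assoc_app.
Qed.

End Structure.

(** * Task-inducing processes *)

Section Tasks.
Variable S : substrate_choice.
Implicit Types H K D E : S.

Definition state H (rho : hom unitO H) (st : states H rho) : states H :=
  SigSub (mem_set st).

Lemma states_tensP H K (t : states (tensO H K)) :
  substrates H -> substrates K ->
  exists (r : states H) (s : states K), \val t = tens_state (\val r) (\val s).
Proof.
move=> sH sK; have [_ _ sur] := states_tens sH sK.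
have [[r s] [/= str sts] rs] := sur _ (set_valP t).
by exists (state str), (state sts).
Qed.

Lemma tens_states H K (r : states H) (s : states K) :
  substrates H -> substrates K ->
  exists t : states (tensO H K), \val t = tens_state (\val r) (\val s).
Proof.
move=> sH sK; have [maps _ _] := states_tens sH sK.
have st := maps (\val r, \val s) (conj (set_valP r) (set_valP s)).
by exists (state st).
Qed.

Lemma tens_states_inj H K (r r' : states H) (s s' : states K) :
  substrates H -> substrates K ->
  tens_state (\val r) (\val s) = tens_state (\val r') (\val s') ->
  r = r' /\ s = s'.
Proof.
move=> sH sK rs; have [_ inj _] := states_tens sH sK.
have mem (a : states H) (b : states K) :
    (\val a, \val b) \in (states H `*` states K)%classic.
  by apply/mem_set; split; exact: set_valP.
by case: (inj _ _ (mem r s) (mem r' s') rs) => /val_inj -> /val_inj ->.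
Qed.

(** The output state of a task-inducing process on composite substrates splits
    again, since every state of a composite substrate is a product. *)
Lemma task_inducing_tens_app H D K E (f : hom (tensO H D) (tensO K E))
    (r : states H) (d : states D) :
  substrates H -> substrates D -> substrates K -> substrates E ->
  task_inducing f ->
  exists (r' : states K) (d' : states E),
    hcomp f (tens_state (\val r) (\val d)) = tens_state (\val r') (\val d').
Proof.
move=> sH sD sK sE indf; have [t <-] := tens_states r d sH sD.
have [r' [d' e]] := states_tensP (state (indf _ (set_valP t))) sK sE.
by exists r', d'.
Qed.

(** States of a composite substrate are product states, so it suffices to test
    task-inducing on those. *)
Lemma task_inducing_from_tens H K E (f : hom (tensO H K) E) :
  substrates H -> substrates K ->
  (forall (r : states H) (s : states K),
     states E (hcomp f (tens_state (\val r) (\val s)))) ->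
  task_inducing f.
Proof.
move=> sH sK indf t stt.
by have [r [s /= ->]] := states_tensP (state stt) sH sK; exact: indf.
Qed.

Lemma states_tens_state H K (r : hom unitO H) (s : hom unitO K) :
  substrates H -> substrates K -> states H r -> states K s ->
  states (tensO H K) (tens_state r s).
Proof.
move=> sH sK str sts; have [maps _ _] := states_tens sH sK.
exact: (maps (r, s)).
Qed.

(** * The four closure properties *)

(** The unit, with its single state as attribute, is an inert catalyst. *)
Lemma possible_id H : substrates H -> possible (@diagonal (states H)).
Proof.
move=> sH; exists unitO, setT, (idm _); split=> //.
- exact: substrates_unit.
- by move=> t stt; rewrite hcomp1m.
- have stI : states (unitO : S) (idm unitO) by rewrite states_unit.
  apply/seteqP; split=> -[r r'] /=.
    rewrite /diagonal /= => <-; exists (state stI), (state stI).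
    by rewrite hcomp1m.
  move=> [g [g' [_]]]; rewrite hcomp1m.
  by case/(tens_states_inj sH (@substrates_unit S)).
Qed.

Lemma possible_swap H K : substrates H -> substrates K ->
  possible (on_tens (@task_swap (states H) (states K))).
Proof.
move=> sH sK.
have sI := @substrates_unit S.
have stI : states (unitO : S) (idm unitO) by rewrite states_unit.
have sHK := substrates_tens sH sK; have sKH := substrates_tens sK sH.
exists unitO, setT, (tensM (sym H K) (idm _)); split=> //.
- apply: task_inducing_from_tens => // t u.
  have [r [s ->]] := states_tensP t sH sK.
  rewrite tens_app sym_app hcomp1m.
  apply: states_tens_state => //; last exact: set_valP.
  by apply: states_tens_state => //; exact: set_valP.
- apply/seteqP; split=> -[t t'] /=.
    move=> [[r s] [[s' r'] [/= [-> ->] et et']]].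
    by exists (state stI), (state stI); rewrite tens_app et sym_app hcomp1m et'.
  move=> [u [u' [_]]]; have [r [s et]] := states_tensP t sH sK.
  have [t2 et2] := tens_states s r sK sH.
  rewrite tens_app et sym_app hcomp1m -et2 => /(tens_states_inj sKH sI)[<- _].
  by exists (r, s), (s, r).
Qed.

(** The attribute [P × Q]; its elements are states of [D ⊗ E], hence named
    through their factors. *)
Definition attr_prod D E (P : set (states D)) (Q : set (states E)) :
    set (states (tensO D E)) :=
  [set t | exists d e, [/\ P d, Q e & \val t = tens_state (\val d) (\val e)]]%classic.

(** Both catalysts are held throughout.  The swaps of [D] and [E] put the one in
    use next to the data. *)
Lemma possible_comp H K L (A : task (states H) (states K))
    (B : task (states K) (states L)) :
  substrates H -> substrates K -> substrates L ->
  possible A -> possible B -> possible (B \; A)%relation.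
Proof.
move=> sH sK sL [D [P [f [sD indf -> presf]]]] [E [Q [g [sE indg -> presg]]]].
have sDE := substrates_tens sD sE.
pose F := hcomp (tensM (idm L) (sym E D)) (hcomp (act_first D g)
            (hcomp (tensM (idm K) (sym D E)) (act_first E f))).
have FE (h : states H) (d : states D) (e : states E) (k : states K)
      (d' : states D) (l : states L) (e' : states E) :
    hcomp f (tens_state (\val h) (\val d)) = tens_state (\val k) (\val d') ->
    hcomp g (tens_state (\val k) (\val e)) = tens_state (\val l) (\val e') ->
    hcomp F (tens_state (\val h) (tens_state (\val d) (\val e))) =
    tens_state (\val l) (tens_state (\val d') (\val e')).
  move=> fE gE; rewrite -3!hcompA (act_first_app _ fE) tens_app sym_app hcomp1m.
  by rewrite (act_first_app _ gE) tens_app sym_app hcomp1m.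
(* Being task-inducing makes both stages total on product states, so any use of
   F can be replayed stage by stage. *)
have Fstep (h : states H) (d : states D) (e : states E) :
    exists (k : states K) (d' : states D) (l : states L) (e' : states E)
      (t' : states (tensO D E)),
    [/\ hcomp f (tens_state (\val h) (\val d)) = tens_state (\val k) (\val d'),
        hcomp g (tens_state (\val k) (\val e)) = tens_state (\val l) (\val e'),
        \val t' = tens_state (\val d') (\val e') &
        hcomp F (tens_state (\val h) (tens_state (\val d) (\val e))) =
        tens_state (\val l) (\val t')].
  have [k [d' fE]] := task_inducing_tens_app h d sH sD sK sD indf.
  have [l [e' gE]] := task_inducing_tens_app k e sK sE sL sE indg.
  have [t' tE] := tens_states d' e' sD sE.
  by exists k, d', l, e', t'; rewrite tE; split=> //; exact: FE fE gE.
exists (tensO D E), (attr_prod P Q), F; split=> //.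
- apply: task_inducing_from_tens => // h t.
  have [d [e ->]] := states_tensP t sD sE.
  have [k [d' [l [e' [t' [_ _ _ ->]]]]]] := Fstep h d e.
  by apply: states_tens_state => //; exact: set_valP.
- apply/seteqP; split=> -[h l] /=.
    move=> [k [d [d' [Pd fE]]] [e [e' [Qe gE]]]].
    have [t tE] := tens_states d e sD sE.
    have [t' tE'] := tens_states d' e' sD sE.
    exists t, t'; split; first by exists d, e.
    by rewrite tE tE'; exact: FE fE gE.
  move=> [t [t' [[d [e [Pd Qe ->]]]]]].
  have [k [d' [l' [e' [u [fE gE _ ->]]]]]] := Fstep h d e.
  case/(tens_states_inj sL sDE) => <- _.
  by exists k; [exists d, d' | exists e, e'].
- move=> h t l t' [d [e [Pd Qe ->]]].
  have [k [d' [l' [e' [u [fE gE uE ->]]]]]] := Fstep h d e.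
  case/(tens_states_inj sL sDE) => _ <-.
  by exists d', e'; split=> //; [exact: presf Pd fE | exact: presg Qe gE].
Qed.

(** [f ⊗ g] expects each input beside its own catalyst; [interchange] brings the
    catalysts there and collects them again afterwards. *)
Lemma possible_prod H K H' K' (A : task (states H) (states K))
    (B : task (states H') (states K')) :
  substrates H -> substrates K -> substrates H' -> substrates K' ->
  possible A -> possible B -> possible (on_tens (task_prod A B)).
Proof.
move=> sH sK sH' sK' [D [P [f [sD indf -> presf]]]] [E [Q [g [sE indg -> presg]]]].
have sDE := substrates_tens sD sE.
have sHH := substrates_tens sH sH'; have sKK := substrates_tens sK sK'.
pose F := hcomp (interchange K D K' E)
            (hcomp (tensM f g) (interchange H H' D E)).
have FE (h : states H) (h' : states H') (d : states D) (e : states E)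
      (k : states K) (k' : states K') (d' : states D) (e' : states E) :
    hcomp f (tens_state (\val h) (\val d)) = tens_state (\val k) (\val d') ->
    hcomp g (tens_state (\val h') (\val e)) = tens_state (\val k') (\val e') ->
    hcomp F (tens_state (tens_state (\val h) (\val h'))
                        (tens_state (\val d) (\val e))) =
    tens_state (tens_state (\val k) (\val k'))
               (tens_state (\val d') (\val e')).
  by move=> fE gE; rewrite -2!hcompA interchange_app tens_app fE gE interchange_app.
have Fstep (h : states H) (h' : states H') (d : states D) (e : states E) :
    exists (k : states K) (k' : states K') (d' : states D) (e' : states E)
      (q : states (tensO K K')) (t' : states (tensO D E)),
    [/\ hcomp f (tens_state (\val h) (\val d)) = tens_state (\val k) (\val d'),
        hcomp g (tens_state (\val h') (\val e)) = tens_state (\val k') (\val e'),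
        \val q = tens_state (\val k) (\val k'),
        \val t' = tens_state (\val d') (\val e') &
        hcomp F (tens_state (tens_state (\val h) (\val h'))
                            (tens_state (\val d) (\val e))) =
        tens_state (\val q) (\val t')].
  have [k [d' fE]] := task_inducing_tens_app h d sH sD sK sD indf.
  have [k' [e' gE]] := task_inducing_tens_app h' e sH' sE sK' sE indg.
  have [q qE] := tens_states k k' sK sK'.
  have [t' tE] := tens_states d' e' sD sE.
  by exists k, k', d', e', q, t'; rewrite qE tE; split=> //; exact: FE fE gE.
exists (tensO D E), (attr_prod P Q), F; split=> //.
- apply: task_inducing_from_tens => // p t.
  have [h [h' ->]] := states_tensP p sH sH'.
  have [d [e ->]] := states_tensP t sD sE.
  have [k [k' [d' [e' [q [t' [_ _ _ _ ->]]]]]]] := Fstep h h' d e.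
  by apply: states_tens_state => //; exact: set_valP.
- apply/seteqP; split=> -[p q] /=.
    move=> [[h h'] [[k k'] [[/= [d [d' [Pd fE]]] [e [e' [Qe gE]]]] pE qE]]].
    have [t tE] := tens_states d e sD sE.
    have [t' tE'] := tens_states d' e' sD sE.
    exists t, t'; split; first by exists d, e.
    by rewrite pE qE tE tE'; exact: FE fE gE.
  move=> [t [t' [[d [e [Pd Qe ->]]]]]].
  have [h [h' pE]] := states_tensP p sH sH'; rewrite pE.
  have [k [k' [d' [e' [q' [u [fE gE qE _ ->]]]]]]] := Fstep h h' d e.
  case/(tens_states_inj sKK sDE) => <- _.
  exists (h, h'), (k, k'); split=> //.
  by split; [exists d, d' | exists e, e'].
- move=> p t q t' [d [e [Pd Qe ->]]].
  have [h [h' pE]] := states_tensP p sH sH'; rewrite pE.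
  have [k [k' [d' [e' [q' [u [fE gE _ uE ->]]]]]]] := Fstep h h' d e.
  case/(tens_states_inj sKK sDE) => _ <-.
  by exists d', e'; split=> //; [exact: presf Pd fE | exact: presg Qe gE].
Qed.

End Tasks.

Theorem proposition3p4 (S : substrate_choice) :
  [/\ (* identities *)
      forall H : S, substrates H ->
        possible (@diagonal (states H)),
      (* symmetries *)
      forall H K : S, substrates H -> substrates K ->
        possible (on_tens (@task_swap (states H) (states K))),
      (* sequential composition *)
      forall (H K L : S)
          (A : task (states H) (states K)) (B : task (states K) (states L)),
        substrates H -> substrates K -> substrates L ->
        possible A -> possible B -> possible (B \; A)%relation &
      (* parallel composition *)
      forall (H K H' K' : S)
          (A : task (states H) (states K)) (B : task (states H') (states K')),
        substrates H -> substrates K -> substrates H' -> substrates K' ->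
        possible A -> possible B ->
        possible (on_tens (task_prod A B))].
Proof.
split.
- exact: possible_id.
- exact: possible_swap.
- exact: possible_comp.
- exact: possible_prod.
Qed.
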